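(* Let $0<a<b$, $\alpha\in(0,1)$, $x_0\in\mathbb{R}$, and let $f:[a,b]\times\mathbb{R}\to\mathbb{R}$ be continuous. Consider the initial value problem $$x^{(\alpha)}(t)=f(t,x(t)),\quad t\in[a,b],\qquad x(a)=x_0. \qquad (P)$$ If $(v,M)\in C^{(\alpha)}([a,b],\mathbb{R})\times C^{(\alpha)}([a,b],[0,\infty))$ is a tube solution to problem $(P)$, then problem $(P)$ has a solution $x\in C^{(\alpha)}([a,b],\mathbb{R})\cap \mathbf{T}(v,M)$, where $$\mathbf{T}(v,M):=\left\{x\in C^{(\alpha)}([a,b],\mathbb{R}) : |x(t)-v(t)|\le M(t),\ t\in[a,b]\right\}.$$
   Context: Conformable fractional derivative: for $\alpha\in(0,1)$ and $t>0$, $f^{(\alpha)}(t):=\lim_{\epsilon\to 0}\frac{f(t+\epsilon t^{1-\alpha})-f(t)}{\epsilon}$; $f$ is called $\alpha$-differentiable at $t$ if this limit exists. For functions defined on $[a,b]$ with $0<a<b$, the limit at the endpoints is understood as the one-sided limit. $C^{(\alpha)}([a,b],\mathbb{R})$ is the set of functions $f:[a,b]\to\mathbb{R}$ that are $\alpha$-differentiable on $[a,b]$ with continuous $f^{(\alpha)}$; $C^{(\alpha)}([a,b],[0,\infty))$ is the subset of those with values in $[0,\infty)$. Tube solution: $(v,M)\in C^{(\alpha)}([a,b],\mathbb{R})\times C^{(\alpha)}([a,b],[0,\infty))$ is a tube solution to problem $(P)$ if (i) $(y-v(t))\,(f(t,y)-v^{(\alpha)}(t))\le M(t)M^{(\alpha)}(t)$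 for every $t\in[a,b]$ and every $y\in\mathbb{R}$ such that $|y-v(t)|=M(t)$; (ii) $v^{(\alpha)}(t)=f(t,v(t))$ and $M^{(\alpha)}(t)=0$ for all $t\in[a,b]$ such that $M(t)=0$; (iii) $|x_0-v(a)|\le M(a)$. *)

(* Defs.v *)
From HB Require Import structures.
From mathcomp Require Import all_boot all_order all_algebra.
From mathcomp Require Import all_classical all_reals all_analysis.
Set Implicit Arguments.
Unset Strict Implicit.
Unset Printing Implicit Defensive.
Import Order.TTheory GRing.Theory Num.Theory.
Import numFieldNormedType.Exports.
Local Open Scope classical_set_scope.
Local Open Scope ring_scope.

(** Functions on [a, b] are total functions R -> R of which only the values on
    [a, b] matter: every limit and continuity condition is relative to [a, b]. *)

Section ConformableDerivative.
Variables (R : realType) (a b alpha : R).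

Definition conf_quotient (g : R -> R) (t eps : R) : R :=
  (g (t + eps * t `^ (1 - alpha)) - g t) / eps.

(** eps tends to 0 by nonzero values that keep the argument of g in [a, b]:
    the limit is two-sided for a < t < b, from the right at a, from the left
    at b. *)
Definition conf_filter (t : R) : set_system R :=
  within [set eps | t + eps * t `^ (1 - alpha) \in `[a, b]] 0^'.

Definition conf_derivable (g : R -> R) (t : R) : Prop :=
  cvg (conf_quotient g t @ conf_filter t).

(** Meaningful only when [conf_derivable g t] holds. *)
Definition conf_derive (g : R -> R) (t : R) : R :=
  lim (conf_quotient g t @ conf_filter t).

Definition Calpha : set (R -> R) :=
  [set g | (forall t, t \in `[a, b] -> conf_derivable g t) /\
           {within `[a, b], continuous (conf_derive g)}].

Definition Calpha_nneg : set (R -> R) :=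
  [set g | Calpha g /\ forall t, t \in `[a, b] -> 0 <= g t].

Definition is_solution (f : R * R -> R) (x0 : R) (x : R -> R) : Prop :=
  (forall t, t \in `[a, b] ->
     conf_derivable x t /\ conf_derive x t = f (t, x t)) /\
  x a = x0.

Definition tube_solution (f : R * R -> R) (x0 : R) (v M : R -> R) : Prop :=
  [/\ Calpha v, Calpha_nneg M,
      forall t y, t \in `[a, b] -> `|y - v t| = M t ->
        (y - v t) * (f (t, y) - conf_derive v t) <= M t * conf_derive M t,
      forall t, t \in `[a, b] -> M t = 0 ->
        conf_derive v t = f (t, v t) /\ conf_derive M t = 0
    & `|x0 - v a| <= M a].

Definition tube (v M : R -> R) : set (R -> R) :=
  [set x | Calpha x /\ forall t, t \in `[a, b] -> `|x t - v t| <= M t].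

End ConformableDerivative.

(* Main.v *)
Require Import Defs.
From HB Require Import structures.
From mathcomp Require Import all_boot all_order all_algebra.
From mathcomp Require Import all_classical all_reals all_analysis.
From mathcomp Require Import ring lra.
Import Order.TTheory GRing.Theory Num.Theory.
Import numFieldNormedType.Exports.
Local Open Scope classical_set_scope.
Local Open Scope ring_scope.

(** Where [t > 0], a conformable derivative is the ordinary one multiplied by
    [t `^ (1 - alpha)], so (P) is the scalar equation
    [x' t = f (t, x t) / t `^ (1 - alpha)].  In one dimension the points at
    distance [M t] of [v t] are [v t - M t] and [v t + M t]; dividing condition
    (i) by [M t] (or using (ii) where [M t = 0]) shows that [v - M] is a lower
    solution and [v + M] an upper solution of that equation, and (iii) that
    they enclose [x0] at time [a].  It remains to solve the equation between
    ordered lower and upper solutions ([lower_upper_solutions]).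

    The right-hand side is first made bounded and globally continuous by
    composing it with the retraction of the plane onto the strip between the
    two barriers ([truncated_field]).  The truncated equation has a global
    solution ([peano_existence]), and that solution cannot leave the strip:
    above the strip it moves with the slope that the field has on the upper
    barrier, hence not faster than the barrier, and likewise below
    ([barrier]).  Inside the strip the two equations agree.

    Peano's theorem is proved without integrals and without the Ascoli
    theorem.  The Euler schemes of step [1 / (n + 1)] are uniformly bounded at
    each time, so that they converge pointwise along an ultrafilter that
    contains the neighborhoods of infinity.  Their increments over an interval
    are close to the length of the interval times [c] as soon as the field is
    close to [c] at the grid points of the interval
    ([euler_increment]); this passes to the pointwise limit
    ([limit_increment]), and continuity of the field at [(t, x t)] turns it
    into a first-order expansion of [x] at [t] ([limit_expansion]).

    All derivatives are handled as first-order expansions relative to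
    [`[a, b]] ([expansion]), which treat interior points and endpoints
    alike. *)

(** * Peano's existence theorem *)

Section Peano.
Set Implicit Arguments.
Unset Strict Implicit.
Variables (R : realType) (G : R * R -> R) (a x0 : R).

Fixpoint euler (h : R) (n : nat) : R :=
  if n is m.+1 then euler h m + h * G (a + m%:R * h, euler h m) else x0.

Definition grid_index (h t : R) : nat := Num.truncn ((t - a) / h).

(** The Euler scheme as a step function of time.  Interpolating it would make it
    continuous, but only its increments up to an error of order [h] matter. *)
Definition euler_step (h t : R) : R := euler h (grid_index h t).

(** Used with [c] the value of the field at a point where it is continuous, and
    with [c = 0] and [e] a bound of the field, which yields a Lipschitz
    estimate. *)
Lemma euler_increment (h c e : R) (j k : nat) :
  0 <= h -> (j <= k)%N ->
  (forall i, (j <= i < k)%N ->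
     `|G (a + i%:R * h, euler h i) - c| <= e) ->
  `|euler h k - euler h j - (k%:R - j%:R) * h * c| <= (k%:R - j%:R) * h * e.
Proof.
move=> h0; elim: k => [|k IHk].
  by rewrite leqn0 => /eqP -> _; rewrite !subrr !mul0r subrr normr0.
rewrite leq_eqVlt => /orP[/eqP <- _|]; first by rewrite !subrr !mul0r subrr normr0.
rewrite ltnS => jk He.
have {}IHk : `|euler h k - euler h j - (k%:R - j%:R) * h * c| <=
    (k%:R - j%:R) * h * e.
  by apply: IHk => // i /andP[ji ik]; apply: He; rewrite ji leqW.
have Hk := He k; rewrite jk ltnSn in Hk; have {}Hk := Hk isT.
rewrite /=.
set y := euler h k in Hk IHk *; set g := G _ in Hk *.
have -> : y + h * g - euler h j - (k.+1%:R - j%:R) * h * c =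
  (y - euler h j - (k%:R - j%:R) * h * c) + h * (g - c) by rewrite -natr1; ring.
apply: (le_trans (ler_normD _ _)); rewrite normrM (ger0_norm h0).
have -> : (k.+1%:R - j%:R) * h * e = (k%:R - j%:R) * h * e + h * e.
  by rewrite -natr1; ring.
by apply: lerD => //; exact: ler_wpM2l.
Qed.

Lemma grid_index_le (h s t : R) :
  0 < h -> s <= t -> (grid_index h s <= grid_index h t)%N.
Proof.
move=> h0 st; apply: le_truncn; rewrite ler_pM2r ?invr_gt0// lerD2r.
exact: st.
Qed.

Lemma grid_index_bounds (h t : R) : 0 < h -> a <= t ->
  t - a - h < (grid_index h t)%:R * h <= t - a.
Proof.
move=> h0 at_.
have z0 : 0 <= (t - a) / h by rewrite divr_ge0 ?subr_ge0// ltW.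
have /andP[l u] := truncn_itv z0.
apply/andP; split; last by rewrite -ler_pdivlMr.
move: u; rewrite ltr_pdivrMr// -natr1 /grid_index; set n := Num.truncn _.
by rewrite mulrDl mul1r [in X in _ -> X]ltrBlDr.
Qed.

Hypothesis G_cont : continuous G.
Variables (K : R).
Hypothesis G_bound : forall p, `|G p| <= K.

Lemma euler_Lipschitz (h : R) (j k : nat) : 0 <= h -> (j <= k)%N ->
  `|euler h k - euler h j| <= (k%:R - j%:R) * h * K.
Proof.
move=> h0 jk; have := @euler_increment h 0 K j k h0 jk.
by rewrite mulr0 subr0; apply => i _; rewrite subr0.
Qed.

(** The bound is uniform in [h]: the values of all the schemes at a given time
    lie in one compact interval. *)
Lemma euler_step_bound (h t : R) : 0 < h ->
  `|euler_step h t| <= `|x0| + `|t - a| * K.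
Proof.
move=> h0.
have K0 : 0 <= K by apply: le_trans (G_bound (0, 0)).
have := @euler_Lipschitz h 0 (grid_index h t) (ltW h0) isT.
rewrite subr0 -/(euler_step h t) /= => H.
have H2 : (grid_index h t)%:R * h <= `|t - a|.
  have [at_|ta] := leP a t.
    have /andP[_ H2] := grid_index_bounds h0 at_.
    exact: le_trans H2 (ler_norm _).
  rewrite /grid_index; have -> : Num.truncn ((t - a) / h) = 0%N.
    by apply/eqP; rewrite -leqn0 truncn_le_nat (@lt_trans _ _ 0)// pmulr_llt0 ?invr_gt0// subr_lt0.
  by rewrite mul0r.
have H3 := ler_wpM2r K0 H2.
rewrite -[euler_step h t](subrK x0).
rewrite addrC (le_trans (ler_normD _ _))// lerD2l.
exact: le_trans H H3.
Qed.

(** Only pointwise convergence along a filter finer than that of infinity is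
    assumed; the uniform Lipschitz estimate on the schemes replaces uniform
    convergence. *)
Section Limit.
Variables (U : set_system nat) (x : R -> R).
Hypotheses (UF : ProperFilter U) (Uoo : \oo `<=` U).
Hypothesis x_lim : forall t, euler_step n.+1%:R^-1 t @[n --> U] --> x t.

Lemma invS_cvg : n.+1%:R^-1 @[n --> U] --> (0 : R).
Proof.
apply/cvgrPdist_lt => e e0.
have := near_infty_natSinv_lt (PosNum e0) => /= /Uoo.
apply: filterS => n.
by rewrite sub0r normrN ger0_norm.
Qed.

Lemma grid_point_cvg (t : R) : a <= t ->
  (grid_index n.+1%:R^-1 t)%:R * n.+1%:R^-1 @[n --> U] --> t - a.
Proof.
move=> at_; apply/cvgrPdist_le => e e0.
have /cvgrPdist_lt/(_ e e0) := invS_cvg.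
apply: filterS => n; rewrite sub0r normrN ger0_norm// => ne.
have h0 : 0 < n.+1%:R^-1 :> R by rewrite invr_gt0.
have /andP[l u] := grid_index_bounds h0 at_.
rewrite ger0_norm ?subr_ge0// lerBlDr -lerBlDl.
by apply: ltW; apply: le_lt_trans l; rewrite lerD2l lerN2 ltW.
Qed.

(** Passing to the limit in [euler_increment]: the number of grid steps
    between [p] and [q], times the step, tends to [q - p]. *)
Lemma limit_increment (c e p q : R) : a <= p -> p <= q ->
  (\forall n \near U, forall i,
     (grid_index n.+1%:R^-1 p <= i < grid_index n.+1%:R^-1 q)%N ->
     `|G (a + i%:R * n.+1%:R^-1, euler n.+1%:R^-1 i) - c| <= e) ->
  `|x q - x p - (q - p) * c| <= (q - p) * e.
Proof.
move=> ap pq He.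
have aq := le_trans ap pq.
have W : ((grid_index n.+1%:R^-1 q)%:R - (grid_index n.+1%:R^-1 p)%:R)
   * n.+1%:R^-1 @[n --> U] --> q - p.
  have -> : q - p = (q - a) - (p - a) by ring.
  under eq_fun do rewrite mulrBl.
  by apply: cvgB; exact: grid_point_cvg.
suff : \forall n \near U, `|euler_step n.+1%:R^-1 q - euler_step n.+1%:R^-1 p -
    ((grid_index n.+1%:R^-1 q)%:R - (grid_index n.+1%:R^-1 p)%:R) * n.+1%:R^-1 * c|
    <= ((grid_index n.+1%:R^-1 q)%:R - (grid_index n.+1%:R^-1 p)%:R) * n.+1%:R^-1 * e.
  apply: (ler_cvg_to
    (cvg_norm (cvgB (cvgB (@x_lim q) (@x_lim p)) (cvgM W (cvg_cst c))))
    (cvgM W (cvg_cst e))).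
apply: filterS He => n He.
apply: euler_increment => //.
exact: grid_index_le.
Qed.

Lemma limit_Lipschitz (p q : R) : a <= p -> p <= q ->
  `|x q - x p| <= (q - p) * K.
Proof.
move=> ap pq; have := @limit_increment 0 K p q ap pq.
rewrite mulr0 subr0; apply; apply: filterE => n i _; by rewrite subr0.
Qed.

(** Near [(t, y)] the field is almost constant, and a scheme that passes near
    [y] at a time [p] near [t] stays near [y] until [q], as its speed is at most
    [K].  The anchor [(t, y)] is kept apart from [p] and [q] so that [t] can be
    either end of the interval. *)
Lemma limit_expansion_between (t y e : R) : 0 < e ->
  exists2 d, 0 < d & forall p q, a <= p -> p <= q ->
    `|p - t| < d -> `|q - t| < d -> `|x p - y| < d ->
    `|x q - x p - (q - p) * G (t, y)| <= (q - p) * e.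
Proof.
move=> e0.
have K0 : 0 <= K by apply: le_trans (G_bound (0, 0)).
have /cvgrPdist_lt/(_ e e0) := @G_cont (t, y).
move=> /nbhs_ballP[r /= r0 Gr].
(* The grid points between [p] and [q] are within [2 * d] of [t], and the
   scheme there is within [2 * d + 3 * d * K] of [y]: one [d] for the distance
   of [x p] to [y], one for that of the scheme to [x p], and [3 * d * K] for a
   lapse of time at most [3 * d]. *)
pose d := r / (4 * (1 + K)).
have D : d * (1 + K) = r / 4 by rewrite /d; field; lra.
have d0 : 0 < d by rewrite divr_gt0// mulr_gt0//; lra.
exists d => // p q ap pq; rewrite !ltr_distl => pt qt xp.
apply: limit_increment => //.
have /cvgrPdist_lt/(_ d d0) := @x_lim p.
have /cvgrPdist_lt/(_ d d0) := invS_cvg.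
apply: filterS2 => n; rewrite sub0r normrN ger0_norm//.
set h := n.+1%:R^-1 => hd; rewrite ltr_distl => xhp i /andP[pi iq].
have h0 : 0 < h by rewrite invr_gt0.
have /andP[pl pu] := grid_index_bounds h0 ap.
have /andP[ql qu] := grid_index_bounds h0 (le_trans ap pq).
have pih : (grid_index h p)%:R * h <= i%:R * h by rewrite ler_pM2r// ler_nat.
have iqh : i%:R * h <= (grid_index h q)%:R * h.
  by rewrite ler_pM2r// ler_nat ltnW.
have := euler_Lipschitz (ltW h0) pi; rewrite -/(euler_step h p).
have : (i%:R - (grid_index h p)%:R) * h * K <= (3 * d) * K.
  apply: ler_wpM2r => //; rewrite mulrBl; lra.
set z := _ * h * K => zK; rewrite ler_distl => yi.
rewrite distrC ltW//; apply: Gr; split => /=; rewrite /ball /= ltr_distl; nra.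
Qed.

Lemma limit_expansion (t e : R) : a <= t -> 0 < e ->
  exists2 d, 0 < d & forall s, a <= s -> `|s - t| < d ->
    `|x s - x t - (s - t) * G (t, x t)| <= `|s - t| * e.
Proof.
move=> at_ e0.
have K0 : 0 <= K by apply: le_trans (G_bound (0, 0)).
have [d d0 H] := limit_expansion_between t (x t) e0.
have d'0 : 0 < d / (1 + K) by rewrite divr_gt0//; lra.
have D : d / (1 + K) * (1 + K) = d by field; lra.
exists (d / (1 + K)) => // s as_ std.
have std1 : `|s - t| < d by nra.
have [ts|/ltW st] := leP t s.
  rewrite (ger0_norm (x := s - t)) ?subr_ge0//.
  by apply: H => //; rewrite ?subrr ?normr0.
rewrite (distrC s) in std std1 *; rewrite ger0_norm ?subr_ge0// in std *.
have -> : x s - x t - (s - t) * G (t, x t) =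
  - (x t - x s - (t - s) * G (t, x t)) by ring.
rewrite normrN; apply: H => //; rewrite ?subrr ?normr0//.
  by rewrite distrC.
rewrite distrC; apply: le_lt_trans (limit_Lipschitz as_ st) _.
nra.
Qed.

End Limit.

Theorem peano_existence : exists x : R -> R, x a = x0 /\
  forall t e, a <= t -> 0 < e -> exists2 d, 0 < d &
    forall s, a <= s -> `|s - t| < d ->
      `|x s - x t - (s - t) * G (t, x t)| <= `|s - t| * e.
Proof.
have [U [UU Uoo]] := ultraFilterLemma (eventually_filter : ProperFilter \oo).
have ex t : exists y : R, euler_step n.+1%:R^-1 t @[n --> U] --> y.
  pose B := `|x0| + `|t - a| * K.
  have UB : (euler_step n.+1%:R^-1 t @[n --> U]) `[- B, B]%classic.
    apply: (@filterE _ U) => n /=; rewrite in_itv/= -ler_norml.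
    by apply: euler_step_bound; rewrite invr_gt0.
  have [y [_ cy]] := segment_compact _ UB.
  exists y => A yA /=.
  (* The ultrafilter decides whether the scheme is in a given neighborhood [A]
     of the cluster point; the complement would miss [A]. *)
  case: (in_ultra_setVsetC ((fun n => euler_step n.+1%:R^-1 t) @^-1` A) UU) => //.
  by move=> nA; have [z []] := cy (~` A) A nA yA.
have [x xU] := choice ex.
exists x; split; last first.
  by move=> t e at_ e0; apply: (limit_expansion (U := U)).
apply: (cvg_unique _ (xU a)) => //.
apply: cvg_near_cst; apply: filterE => n.
by rewrite /euler_step /grid_index subrr mul0r truncn0.
Qed.
End Peano.

(** * First-order expansions and a comparison principle *)

Section Expansion.
Set Implicit Arguments.
Unset Strict Implicit.
Variables (R : realType) (a b : R).

(** [L] is the derivative of [g] at [t] relative to [`[a, b]]: two-sided inside,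
    one-sided at the endpoints. *)
Definition expansion (g : R -> R) (t L : R) : Prop :=
  forall e, 0 < e -> exists2 d, 0 < d & forall s, s \in `[a, b] ->
    `|s - t| < d -> `|g s - g t - (s - t) * L| <= `|s - t| * e.

Lemma expansionD (g h : R -> R) (t L N : R) :
  expansion g t L -> expansion h t N -> expansion (g \+ h) t (L + N).
Proof.
move=> Hg Hh e e0.
have e20 : 0 < e / 2 by rewrite divr_gt0.
have [d d0 {}Hg] := Hg _ e20; have [d' d'0 {}Hh] := Hh _ e20.
exists (Num.min d d'); first by rewrite lt_min d0.
move=> s sab; rewrite lt_min => /andP[/(Hg _ sab) sd /(Hh _ sab) sd'] /=.
have -> : g s + h s - (g t + h t) - (s - t) * (L + N) =
  (g s - g t - (s - t) * L) + (h s - h t - (s - t) * N) by ring.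
apply: (le_trans (ler_normD _ _)); apply: (le_trans (lerD sd sd')).
by rewrite -mulrDr -splitr.
Qed.

Lemma expansionN (g : R -> R) (t L : R) :
  expansion g t L -> expansion (\- g) t (- L).
Proof.
move=> Hg e /Hg[d d0 {}Hg]; exists d => // s sab /(Hg _ sab) /=.
by have -> : - g s - - g t - (s - t) * - L = - (g s - g t - (s - t) * L);
  [ring | rewrite normrN].
Qed.

Lemma expansion_continuous (g L : R -> R) :
  (forall t, t \in `[a, b] -> expansion g t (L t)) ->
  {within `[a, b], continuous g}.
Proof.
move=> H; apply/subspace_continuousP => t /= tab.
apply/cvgrPdist_lt => e e0.
have [d d0 Hd] := H t tab _ ltr01.
have B0 : 0 < `|L t| + 1 by rewrite ltr_wpDl.
apply/nbhs_ballP; exists (Num.min d (e / (`|L t| + 1))).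
  by rewrite /= lt_min d0 divr_gt0.
move=> s; rewrite /ball/= (distrC t) lt_min => /andP[sd se] sab.
have := Hd s sab sd; rewrite mulr1 => Hs.
rewrite distrC; have -> : g s - g t = (g s - g t - (s - t) * L t) + (s - t) * L t.
  by ring.
apply: (le_lt_trans (ler_normD _ _)).
rewrite normrM; rewrite ltr_pdivlMr// in se.
apply: le_lt_trans se; rewrite mulrDr mulr1 addrC lerD2l.
exact: Hs.
Qed.

(** If [w] were positive somewhere, so would be [w t - k * (t - a)] for a small
    [k > 0].  This function is not positive at [a], hence its maximum is
    reached at some [c > a], where difference quotients from the left give
    [k <= L c].  But [w c > 0] forces [L c <= 0]. *)
Lemma barrier (w L : R -> R) :
  (forall t, t \in `[a, b] -> expansion w t (L t)) -> w a <= 0 ->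
  (forall t, t \in `[a, b] -> 0 < w t -> L t <= 0) ->
  forall t, t \in `[a, b] -> w t <= 0.
Proof.
move=> Hw wa HL t1 t1ab; rewrite leNgt; apply/negP => wt1.
have [at1 t1b] : a <= t1 /\ t1 <= b by move: t1ab; rewrite in_itv/= => /andP.
have ab := le_trans at1 t1b.
(* Small enough for [w t - k * (t - a)] to stay positive at [t1]; the [+ 1]
   keeps the denominator nonzero when [t1 = a]. *)
pose k := w t1 / (2 * (t1 - a + 1)).
have q0 : 0 < 2 * (t1 - a + 1) by rewrite mulr_gt0//; lra.
have k0 : 0 < k by rewrite divr_gt0.
have kt : 0 < w t1 - k * (t1 - a).
  have kq : k * (2 * (t1 - a + 1)) = w t1 by rewrite divfK ?gt_eqF.
  rewrite subr_gt0 -kq; nra.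
pose u := w \+ (\- (fun t => k * (t - a))).
have Hk t : expansion (fun t => k * (t - a)) t k.
  move=> e e0; exists 1 => // s _ _.
  have -> : k * (s - a) - k * (t - a) - (s - t) * k = 0 by ring.
  by rewrite normr0 mulr_ge0// ltW.
have Hu t : t \in `[a, b] -> expansion u t (L t - k).
  by move=> tab; apply: expansionD; [exact: Hw | exact/expansionN/Hk].
have [c cab cmax] := EVT_max ab (expansion_continuous Hu).
have uc : 0 < u c by apply: lt_le_trans (cmax _ t1ab); rewrite /u/=.
have ac : a < c.
  have ac : a <= c by move: cab; rewrite in_itv/= => /andP[].
  rewrite lt_neqAle ac andbT; apply/eqP => ac'.
  by move: uc; rewrite /u/= -ac' subrr mulr0 subr0 ltNge wa.
have wc : 0 < w c.
  apply: lt_le_trans uc _; rewrite /u/= gerBl mulr_ge0// ?ltW// subr_gt0//.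
have Lc := HL _ cab wc.
(* As [L c - k <= - k], the expansion with error [k / 2] makes [u] larger at
   [c - r] than at its maximum [c]. *)
have [d d0 Hd] := Hu c cab (k / 2) (divr_gt0 k0 (ltr0n _ 2)).
pose r := Num.min (d / 2) (c - a).
have r0 : 0 < r by rewrite lt_min divr_gt0//= subr_gt0.
have rd : r < d by apply: (@le_lt_trans _ _ (d / 2)); [rewrite ge_min lexx | lra].
have rc : r <= c - a by rewrite ge_min lexx orbT.
have sab : c - r \in `[a, b].
  by move: cab; rewrite !in_itv/= => /andP[_ cb]; apply/andP; split; lra.
have := cmax _ sab; have := Hd _ sab.
have -> : c - r - c = - r by ring.
rewrite normrN (gtr0_norm r0) => /(_ rd); rewrite ler_norml => /andP[Hl _] Hm.
nra.
Qed.

End Expansion.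

(** * Conformable derivatives as expansions *)

Section Conformable.
Set Implicit Arguments.
Unset Strict Implicit.
Variables (R : realType) (a b alpha : R).
Hypotheses (a0 : 0 < a) (ab : a < b).

Let itv_gt0 t : t \in `[a, b] -> 0 < t.
Proof. by rewrite in_itv/= => /andP[/(lt_le_trans a0)]. Qed.

Let scale_gt0 t : t \in `[a, b] -> 0 < t `^ (1 - alpha).
Proof. by move=> /itv_gt0; exact: powR_gt0. Qed.

(** Limits along [conf_filter] are unique: since [a < b], from any [t] one can
    move by a small amount into [`[a, b]], to the right in its left half and to
    the left in its right half. *)
Lemma conf_filter_proper t : t \in `[a, b] -> ProperFilter (conf_filter a b alpha t).
Proof.
move=> tab; have c0 := scale_gt0 tab; set c := _ `^ _ in c0 *.
split; last by rewrite /conf_filter; exact: within_filter.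
move=> /nbhs_ballP[r /= r0 H].
pose d := Num.min (r / 2) ((b - a) / (2 * c)).
have d0 : 0 < d by rewrite lt_min !divr_gt0 ?mulr_gt0 ?subr_gt0.
have dr : d < r by apply: (@le_lt_trans _ _ (r / 2)); [rewrite ge_min lexx | lra].
have dc : d * c <= (b - a) / 2.
  have : d <= (b - a) / (2 * c) by rewrite ge_min lexx orbT.
  by rewrite ler_pdivlMr ?mulr_gt0// => ?; lra.
have dc0 : 0 < d * c by rewrite mulr_gt0.
move: tab; rewrite in_itv/= => /andP[at_ tb].
have [tm|mt] := leP t ((a + b) / 2).
  apply: (H d); rewrite /= /ball/= ?sub0r ?normrN ?gtr0_norm//.
    by rewrite gt_eqF.
  by rewrite in_itv/= -/c; apply/andP; split; lra.
apply: (H (- d)); rewrite /= /ball/= ?sub0r ?opprK ?gtr0_norm//.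
  by rewrite oppr_eq0 gt_eqF.
by rewrite in_itv/= -/c; apply/andP; split; lra.
Qed.

(** The substitution [s = t + eps * t `^ (1 - alpha)], whose factor is a positive
    constant, turns one condition into the other. *)
Lemma conf_limitP (g : R -> R) (t L : R) : t \in `[a, b] ->
  (conf_quotient alpha g t @ conf_filter a b alpha t --> t `^ (1 - alpha) * L)
  <-> expansion a b g t L.
Proof.
move=> tab; have c0 := scale_gt0 tab.
rewrite /conf_quotient /conf_filter; set c := _ `^ _ in c0 *.
have FF := conf_filter_proper tab; rewrite /conf_filter -/c in FF.
split=> [/cvgrPdist_le H e e0|H].
  have /H : 0 < c * e by rewrite mulr_gt0.
  move=> /nbhs_ballP[r /= r0 Hr].
  exists (r * c); first by rewrite mulr_gt0.
  move=> s sab st.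
  have [->|sDt] := eqVneq s t; first by rewrite !subrr mul0r subrr !normr0 mul0r.
  pose z := (s - t) / c.
  have zc : z * c = s - t by rewrite divfK ?gt_eqF.
  have z0 : z != 0 by rewrite /z mulf_eq0 invr_eq0 subr_eq0 negb_or sDt gt_eqF.
  have tzc : t + z * c = s by rewrite zc addrC subrK.
  have : `|c * L - (g (t + z * c) - g t) / z| <= c * e.
    apply: (Hr z) => //=; last by rewrite tzc.
    by rewrite /ball/= sub0r normrN normrM normfV (gtr0_norm c0) ltr_pdivrMr.
  rewrite tzc.
  rewrite distrC.
  have -> : (g s - g t) / z - c * L = (g s - g t - (s - t) * L) / z.
    by rewrite -zc; field.
  rewrite normrM normfV ler_pdivrMr ?normr_gt0//.
  have -> : `|s - t| = `|z| * c by rewrite -zc normrM (gtr0_norm c0).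
  by have -> : c * e * `|z| = `|z| * c * e by ring.
apply/cvgrPdist_le => e e0.
have [|d d0 Hd'] := H (e / c); first by rewrite divr_gt0.
apply/nbhs_ballP; exists (d / c); first by rewrite /= divr_gt0.
move=> z; rewrite /ball/= sub0r normrN ltr_pdivlMr// => zd z0 sab.
have ts : t + z * c - t = z * c by ring.
have := Hd' _ sab; rewrite ts normrM (gtr0_norm c0) => /(_ zd).
rewrite (distrC (c * L)).
have -> : (g (t + z * c) - g t) / z - c * L = (g (t + z * c) - g t - z * c * L) / z.
  by field.
rewrite normrM normfV ler_pdivrMr ?normr_gt0//.
by have -> : `|z| * c * (e / c) = e * `|z| by field; rewrite gt_eqF.
Qed.

Lemma conf_derivable_expansion (g : R -> R) (t : R) : t \in `[a, b] ->
  conf_derivable a b alpha g t ->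
  expansion a b g t (conf_derive a b alpha g t / t `^ (1 - alpha)).
Proof.
move=> tab gt; apply/(conf_limitP _ _ tab).
by rewrite mulrC divfK// gt_eqF// scale_gt0.
Qed.

Lemma expansion_conf_derive (g : R -> R) (t L : R) : t \in `[a, b] ->
  expansion a b g t L ->
  conf_derivable a b alpha g t /\
  conf_derive a b alpha g t = t `^ (1 - alpha) * L.
Proof.
move=> tab /(conf_limitP _ _ tab) gL.
have FF := conf_filter_proper tab.
by split; [apply/cvg_ex; eexists; exact: gL | exact: cvg_lim gL].
Qed.

End Conformable.

(** * Solutions between lower and upper solutions *)

Section TruncatedField.
Set Implicit Arguments.
Unset Strict Implicit.

Lemma within_continuous_comp (S T V : topologicalType) (A : set T) (B : set S)
    (f : T -> V) (h : S -> T) :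
  {within A, continuous f} -> {within B, continuous h} ->
  (forall s, B s -> A (h s)) -> {within B, continuous (f \o h)}.
Proof.
move=> /subspace_continuousP fA /subspace_continuousP hB BA.
apply/subspace_continuousP => s Bs; apply: cvg_comp (fA _ (BA _ Bs)).
move=> C AC; have := hB s Bs _ AC; rewrite !nbhs_simpl /within /=.
by apply: filterS => z hC Bz; exact: hC (BA _ Bz).
Qed.

Variables (R : realType) (a b : R).
Hypothesis (ab : a <= b).

Definition clamp (l u y : R) : R := Num.max l (Num.min u y).

Lemma clamp_ge (l u y : R) : l <= clamp l u y.
Proof. by rewrite le_max lexx. Qed.

Lemma clamp_le (l u y : R) : l <= u -> clamp l u y <= u.
Proof. by move=> lu; rewrite ge_max lu ge_min lexx. Qed.

Lemma clamp_id (l u y : R) : l <= y -> y <= u -> clamp l u y = y.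
Proof. by move=> ly yu; rewrite /clamp min_r// max_r. Qed.

Lemma clamp_above (l u y : R) : l <= u -> u <= y -> clamp l u y = u.
Proof. by move=> lu uy; rewrite /clamp min_l// max_r. Qed.

Lemma clamp_below (l u y : R) : y <= l -> clamp l u y = l.
Proof. by move=> yl; rewrite /clamp max_l// ge_min yl orbT. Qed.

Lemma clamp_continuous (S : topologicalType) (l u h : S -> R) :
  continuous l -> continuous u -> continuous h ->
  continuous (fun s => clamp (l s) (u s) (h s)).
Proof.
move=> lc uc hc s.
exact: (continuous_max (lc s) (continuous_min (uc s) (hc s))).
Qed.

Variables (F : R * R -> R) (lo hi : R -> R).
Hypotheses (F_cont : {within `[a, b] `*` [set: R], continuous F})
  (lo_cont : {within `[a, b], continuous lo})
  (hi_cont : {within `[a, b], continuous hi})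
  (lohi : forall t, t \in `[a, b] -> lo t <= hi t).

Definition tube_retraction (p : R * R) : R * R :=
  let t := clamp a b p.1 in (t, clamp (lo t) (hi t) p.2).

Definition truncated_field : R * R -> R := F \o tube_retraction.

Let fst_cont : continuous (fun p : R * R => p.1).
Proof. by move=> p; exact: cvg_fst. Qed.

Let snd_cont : continuous (fun p : R * R => p.2).
Proof. by move=> p; exact: cvg_snd. Qed.

Let clamp_ab t : clamp a b t \in `[a, b].
Proof. by rewrite in_itv/= clamp_ge clamp_le. Qed.

Lemma tube_retraction_continuous : continuous tube_retraction.
Proof.
have tc : continuous (fun p : R * R => clamp a b p.1).
  by apply: clamp_continuous => //; move=> p; exact: cvg_cst.
have yc : continuous (fun p : R * R =>
    clamp (lo (clamp a b p.1)) (hi (clamp a b p.1)) p.2).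
  apply: clamp_continuous => //.
  - apply/continuous_subspace_setT; move/continuous_subspace_setT: tc => tc.
    by apply: (within_continuous_comp lo_cont tc) => p _; exact: clamp_ab.
  - apply/continuous_subspace_setT; move/continuous_subspace_setT: tc => tc.
    by apply: (within_continuous_comp hi_cont tc) => p _; exact: clamp_ab.
by move=> p; exact: (cvg_pair (@tc p) (@yc p)).
Qed.

Lemma truncated_field_continuous : continuous truncated_field.
Proof.
apply/continuous_subspace_setT.
move/continuous_subspace_setT: tube_retraction_continuous => rc.
apply: (within_continuous_comp F_cont rc) => p _.
by split => //=; exact: clamp_ab.
Qed.

(** The retraction takes its values in a compact rectangle. *)
Lemma truncated_field_bounded :
  exists K, forall p, `|truncated_field p| <= K.
Proof.
have [tl tlab lmin] := EVT_min ab lo_cont.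
have [tu tuab umax] := EVT_max ab hi_cont.
have Fc : {within `[a, b] `*` `[lo tl, hi tu], continuous F}.
  by apply: continuous_subspaceW F_cont => p [].
have := continuous_compact Fc
  (compact_setX (@segment_compact _ a b) (@segment_compact _ (lo tl) (hi tu))).
move=> /compact_bounded[K [_ KP]].
have {}KP := KP (K + 1) (ltr_pwDr ltr01 (lexx K)).
exists (K + 1) => p; apply: KP.
exists (tube_retraction p) => //; split => /=; first exact: clamp_ab.
have cab := clamp_ab p.1.
rewrite in_itv/= (le_trans (lmin _ cab) (clamp_ge _ _ _))/=.
by rewrite (le_trans (clamp_le _ (lohi cab)) (umax _ cab)).
Qed.

Lemma truncated_fieldE (t y : R) : t \in `[a, b] ->
  truncated_field (t, y) = F (t, clamp (lo t) (hi t) y).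
Proof.
rewrite in_itv/= => /andP[at_ tb].
by rewrite /truncated_field /tube_retraction /= (clamp_id at_ tb).
Qed.

(** Above the strip the slope of the solution [x] of the truncated equation is
    [F (t, hi t) <= dhi t], so that [x - hi] satisfies the comparison principle
    [barrier]; [lo - x] does so by symmetry. *)
Theorem lower_upper_solutions (dlo dhi : R -> R) (x0 : R) :
  (forall t, t \in `[a, b] -> expansion a b lo t (dlo t)) ->
  (forall t, t \in `[a, b] -> expansion a b hi t (dhi t)) ->
  (forall t, t \in `[a, b] -> dlo t <= F (t, lo t)) ->
  (forall t, t \in `[a, b] -> F (t, hi t) <= dhi t) ->
  lo a <= x0 <= hi a ->
  exists x : R -> R, [/\ x a = x0,
    forall t, t \in `[a, b] -> expansion a b x t (F (t, x t)) &
    forall t, t \in `[a, b] -> lo t <= x t <= hi t].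
Proof.
move=> Elo Ehi Flo Fhi /andP[x0l x0u].
have [K GK] := truncated_field_bounded.
have [x [xa xG]] := peano_existence a x0 truncated_field_continuous GK.
have Ex t : t \in `[a, b] -> expansion a b x t (truncated_field (t, x t)).
  rewrite in_itv/= => /andP[at_ tb] e e0; have [d d0 Hd] := xG t e at_ e0.
  exists d => // s; rewrite in_itv/= => /andP[as_ _]; exact: Hd.
have xlo t : t \in `[a, b] -> lo t <= x t.
  move=> tab; rewrite -subr_le0.
  apply: (barrier (w := lo \+ (\- x))
    (L := fun t => dlo t + - truncated_field (t, x t))) tab.
  - by move=> s sab; apply: expansionD; [exact: Elo | exact/expansionN/Ex].
  - by rewrite /= xa subr_le0.
  - move=> s sab /=; rewrite subr_gt0 => /ltW xs.
    by rewrite truncated_fieldE// clamp_below// subr_le0 Flo.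
have xhi t : t \in `[a, b] -> x t <= hi t.
  move=> tab; rewrite -subr_le0.
  apply: (barrier (w := x \+ (\- hi))
    (L := fun t => truncated_field (t, x t) + - dhi t)) tab.
  - by move=> s sab; apply: expansionD; [exact: Ex | exact/expansionN/Ehi].
  - by rewrite /= xa subr_le0.
  - move=> s sab /=; rewrite subr_gt0 => /ltW xs.
    by rewrite truncated_fieldE// clamp_above// ?lohi// subr_le0 Fhi.
exists x; split => // t tab; last by rewrite xlo ?xhi.
by have := Ex t tab; rewrite truncated_fieldE// clamp_id ?xlo ?xhi.
Qed.

End TruncatedField.

(** * Tube solutions *)

Theorem theorem19 (R : realType) (a b alpha x0 : R) (f : R * R -> R)
  (v M : R -> R) :
  0 < a -> a < b -> 0 < alpha -> alpha < 1 ->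
  {within `[a, b] `*` [set: R], continuous f} ->
  tube_solution a b alpha f x0 v M ->
  exists x : R -> R,
    is_solution a b alpha f x0 x /\
    (Calpha a b alpha `&` tube a b alpha v M) x.
Proof.
move=> a0 ab _ _ fc [[vd _] [[Md _] M0] Hb H0 Ha].
pose c t := t `^ (1 - alpha).
have c0 t : t \in `[a, b] -> 0 < c t.
  by rewrite in_itv/= => /andP[/(lt_le_trans a0) t0 _]; exact: powR_gt0.
pose F (p : R * R) := f p / c p.1.
have Fc : {within `[a, b] `*` [set: R], continuous F}.
  apply/subspace_continuousP => p pab.
  have pI : p.1 \in `[a, b] by case: pab.
  apply: cvgM; first exact: (iffLR (subspace_continuousP _ _) fc).
  apply: cvgV; first by rewrite gt_eqF// c0.
  apply: cvg_within_filter.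
  apply: (@cvg_comp _ _ _ fst c) cvg_fst _.
  apply: differentiable_continuous; apply/derivable1_diffP.
  apply: derivable_powR.
  by move: pI; rewrite !in_itv/= => /andP[/(lt_le_trans a0) -> _].
pose Dv := conf_derive a b alpha v; pose DM := conf_derive a b alpha M.
have Ev t : t \in `[a, b] -> expansion a b v t (Dv t / c t).
  by move=> tab; apply: conf_derivable_expansion => //; exact: vd.
have EM t : t \in `[a, b] -> expansion a b M t (DM t / c t).
  by move=> tab; apply: conf_derivable_expansion => //; exact: Md.
have Elo t : t \in `[a, b] -> expansion a b (v \+ \- M) t (Dv t / c t - DM t / c t).
  by move=> tab; apply: expansionD; [exact: Ev | exact/expansionN/EM].
have Ehi t : t \in `[a, b] -> expansion a b (v \+ M) t (Dv t / c t + DM t / c t).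
  by move=> tab; apply: expansionD; [exact: Ev | exact: EM].
have lohi t : t \in `[a, b] -> (v \+ \- M) t <= (v \+ M) t.
  by move=> tab /=; have := M0 t tab; lra.
(* Where [M t > 0], condition (i) at [y = v t - M t] (resp. [v t + M t]) is
   divided by [M t]. *)
have Flo t : t \in `[a, b] -> Dv t / c t - DM t / c t <= F (t, (v \+ \- M) t).
  move=> tab; rewrite -mulrBl ler_pM2r ?invr_gt0 ?c0//=.
  have := M0 t tab; rewrite le0r => /orP[/eqP Mt|Mt].
    by have [vt Mt'] := H0 t tab Mt; rewrite Mt subr0 /Dv /DM vt Mt' subr0.
  have := Hb t (v t - M t) tab; rewrite addrAC subrr add0r normrN gtr0_norm//.
  by move=> /(_ erefl); rewrite -/(Dv t) -/(DM t); nra.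
have Fhi t : t \in `[a, b] -> F (t, (v \+ M) t) <= Dv t / c t + DM t / c t.
  move=> tab; rewrite -mulrDl ler_pM2r ?invr_gt0 ?c0//=.
  have := M0 t tab; rewrite le0r => /orP[/eqP Mt|Mt].
    by have [vt Mt'] := H0 t tab Mt; rewrite Mt addr0 /Dv /DM vt Mt' addr0.
  have := Hb t (v t + M t) tab; rewrite addrAC subrr add0r gtr0_norm//.
  by move=> /(_ erefl); rewrite -/(Dv t) -/(DM t); nra.
have x0ab : (v \+ \- M) a <= x0 <= (v \+ M) a by rewrite -ler_distl.
have [x [xa Ex xt]] := lower_upper_solutions (ltW ab) Fc
  (expansion_continuous Elo) (expansion_continuous Ehi) lohi Elo Ehi Flo Fhi x0ab.
have xc := expansion_continuous Ex.
have sol t : t \in `[a, b] ->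
    conf_derivable a b alpha x t /\ conf_derive a b alpha x t = f (t, x t).
  move=> tab; have [? ->] := expansion_conf_derive alpha a0 ab tab (Ex t tab).
  by split=> //; rewrite /F mulrC divfK// gt_eqF// c0.
have xC : Calpha a b alpha x.
  split=> [t /sol[]//|].
  have pc : {within `[a, b], continuous (fun t => (t, x t))}.
    apply/subspace_continuousP => t tab.
    exact: (cvg_pair (@cvg_within _ _ _ _) (iffLR (subspace_continuousP _ _) xc t tab)).
  have fxc := within_continuous_comp fc pc (fun t tab => conj tab I).
  apply: subspace_eq_continuous fxc => t; rewrite inE => tab.
  have [_ e] := sol t tab.
  exact: esym e.
exists x; do 2!split=> //.
by split=> // t tab; rewrite ler_distl; exact: xt.
Qed.
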